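(* Let $\ell\ge2$, let $K$ be a kernel of order $\ell$, and let $X_1,X_2,\dots$ be iid real random variables with Lebesgue density $f\in W^{\ell,1}$. Let $d=d_\infty$ or $d=d_{kuip,k}$ for some $k\in\mathbb{N}$, and let $s:\mathbb{N}\to(0,\infty)$ satisfy $$s(n)=O\left(\sqrt{\frac{\log\log n}{n}}\right).$$ Let $h_{s,n}>0$ be a bandwidth chosen as a solution $h$ of $d(F_n,\hat F_n^h)=s(n)$. Then almost surely, as $n\to\infty$, $$h_{s,n}=O\left(n^{-\frac1{2\ell}}(\log\log n)^{\frac1{2\ell}}\right).$$
   Context: Kernel: for $\ell\in\mathbb{N}$, $\ell\ge1$, a function $K:\mathbb{R}\to\mathbb{R}$ (not necessarily nonnegative) is a kernel of order $\ell$ if $u^jK(u)\in L_1(\mathbb{R})$ for $j=0,\dots,\ell$, $\int K(u)\,du=1$, $\int u^jK(u)\,du=0$ for $j=1,\dots,\ell-1$, and $\int u^\ell K(u)\,du=k_\ell\in\mathbb{R}\setminus\{0\}$. $\mathbb{K}(x):=\int_{-\infty}^xK(u)\,du$. Sobolev space: $W^{\ell,1}:=\{f:f,f^{(1)},\dots,f^{(\ell)}\in L_1(\mathbb{R})\}$ (weak derivatives). Estimators: $F_n$ is the empirical distribution function of $X_1,\dots,X_n$, and for $h>0$, $\hat F_n^h(x):=\frac1n\sum_{i=1}^n\mathbb{K}\left(\frac{x-X_i}{h}\right)$. Distances: $d_\infty(F,G):=\sup_{x\in\mathbb{R}}|F(x)-G(x)|$; for $k\in\mathbb{N}$, $k\ge1$,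 $$d_{kuip,k}(F,G):=\sup_{a_1\le b_1\le a_2\le b_2\le\dots\le a_k\le b_k}\sum_{i=1}^k|(F(b_i)-F(a_i))-(G(b_i)-G(a_i))|.$$ Chosen bandwidth: $(h_{s,n})$ is an arbitrary sequence of positive random variables (arbitrary data-dependent selection among the solutions if there are several) such that almost surely $d(F_n,\hat F_n^{h_{s,n}})=s(n)$ for all sufficiently large $n$; existence of such solutions is presupposed. *)

(* Defs.v *)
From HB Require Import structures.
From mathcomp Require Import all_boot all_order all_algebra.
From mathcomp Require Import finmap.
From mathcomp Require Import all_classical all_reals all_analysis.

Set Implicit Arguments.
Unset Strict Implicit.
Unset Printing Implicit Defensive.

Import Order.TTheory GRing.Theory Num.Theory.
Import numFieldNormedType.Exports.

Local Open Scope classical_set_scope.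
Local Open Scope ring_scope.

(* Measurability is Borel measurability: L_1 is the space of Borel
   representatives of the classes of Lebesgue-integrable functions. *)
Definition L1 (R : realType) (f : R -> R) : Prop :=
  (@lebesgue_measure R).-integrable [set: R] (EFin \o f).

Definition kernel_of_order (R : realType) (l : nat) (K : R -> R) : Prop :=
  [/\ (1 <= l)%N,
      forall j : nat, (j <= l)%N -> L1 (fun u => u ^+ j * K u),
      \int[@lebesgue_measure R]_(u in [set: R]) K u = 1,
      forall j : nat, (1 <= j < l)%N ->
        \int[@lebesgue_measure R]_(u in [set: R]) (u ^+ j * K u) = 0 &
      \int[@lebesgue_measure R]_(u in [set: R]) (u ^+ l * K u) != 0].

Definition kernel_cdf (R : realType) (K : R -> R) (x : R) : R :=
  \int[@lebesgue_measure R]_(u in `]-oo, x]) K u.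

Definition test_function (R : realType) (phi : R -> R) : Prop :=
  (forall (m : nat) (x : R), derivable (derive1n m phi) x 1) /\
  compact (closure [set x | phi x != 0]).

(* [g] is the [j]-th weak derivative of [f], both being in L_1. *)
Definition weak_derivative (R : realType) (j : nat) (f g : R -> R) : Prop :=
  forall phi : R -> R, test_function phi ->
    \int[@lebesgue_measure R]_(x in [set: R]) (f x * derive1n j phi x) =
    (-1) ^+ j * \int[@lebesgue_measure R]_(x in [set: R]) (g x * phi x).

(* The Sobolev space W^{l,1}. *)
Definition sobolev1 (R : realType) (l : nat) (f : R -> R) : Prop :=
  L1 f /\ forall j : nat, (1 <= j <= l)%N ->
    exists g : R -> R, L1 g /\ weak_derivative j f g.

Definition mutually_independent (disp : measure_display)
    (T : measurableType disp) (R : realType) (P : probability T R)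
    (X : nat -> {RV P >-> R}) : Prop :=
  forall (J : {fset nat}) (B : nat -> set R),
    (forall i, measurable (B i)) ->
    P (\bigcap_(i in [set` J]) (X i @^-1` B i)) =
    (\prod_(i <- J) P (X i @^-1` B i))%E.

Definition iid (disp : measure_display) (T : measurableType disp)
    (R : realType) (P : probability T R) (X : nat -> {RV P >-> R}) : Prop :=
  mutually_independent X /\
  forall (i : nat) (A : set R), measurable A ->
    distribution P (X i) A = distribution P (X 0%N) A.

Definition has_density (disp : measure_display) (T : measurableType disp)
    (R : realType) (P : probability T R) (X : {RV P >-> R}) (f : R -> R)
    : Prop :=
  [/\ measurable_fun [set: R] f,
      forall x, 0 <= f x &
      forall A : set R, measurable A ->
        distribution P X A =
        (\int[@lebesgue_measure R]_(x in A) (f x)%:E)%E].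

(* Samples are indexed from 0: [x 0, ..., x (n - 1)] stands for X_1, ..., X_n. *)
Definition ecdf (R : realType) (x : nat -> R) (n : nat) (t : R) : R :=
  n%:R^-1 * \sum_(i < n) ((x i <= t)%R)%:R.

Definition smoothed_ecdf (R : realType) (K : R -> R) (x : nat -> R) (n : nat)
    (h : R) (t : R) : R :=
  n%:R^-1 * \sum_(i < n) kernel_cdf K ((t - x i) / h).

(* The suprema are taken in the extended reals, where they always exist. *)
Definition d_infty (R : realType) (F G : R -> R) : \bar R :=
  ereal_sup [set `|F x - G x|%:E | x in [set: R]].

(* a_1, b_1, ..., a_k, b_k are [a 0, b 0, ..., a (k - 1), b (k - 1)]; later
   values of [a] and [b] play no role. *)
Definition kuiper_chain (R : realType) (k : nat) (a b : nat -> R) : Prop :=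
  (forall i, (i < k)%N -> a i <= b i) /\
  (forall i, (i.+1 < k)%N -> b i <= a i.+1).

Definition d_kuip (R : realType) (k : nat) (F G : R -> R) : \bar R :=
  ereal_sup [set y : \bar R | exists a b : nat -> R, kuiper_chain k a b /\
    y = (\sum_(i < k) `|(F (b i) - F (a i)) - (G (b i) - G (a i))|)%:E].

(* Main.v *)
(* Fix a smooth probability density psi = - rho', where rho is a decreasing
   logistic function, and integrate the deviation D = F_n - Fhat_n^h against it.
   By Fubini this gives the average over the sample of
   rho(X_i) - int K(u) rho(X_i + h u) du, and the moment conditions on K turn
   each term into - h^l * kappa * rho^(l)(X_i) + o(h^l) with kappa != 0, uniformly
   in X_i.  Since |D| <= s(n), this already bounds h^l by a multiple of s(n),
   as soon as the average of rho^(l)(X_i) stays away from 0.  To ensure the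
   latter, and to rule out large h, the sample is first contracted by a large
   factor lambda around a point where rho^(l) does not vanish: almost surely,
   all but a small proportion of the sample eventually lies in a fixed bounded
   set.  The o(h^l) becomes o((h/lambda)^l), so lambda proportional to h would
   bound s(n) from below when h is large. *)

Require Import Defs.
From mathcomp Require Import all_boot all_order all_algebra.
From mathcomp Require Import finmap ring lra.
From mathcomp Require Import all_classical all_reals all_analysis.
From mathcomp Require Import measurable_realfun.

Set Implicit Arguments.
Unset Strict Implicit.
Unset Printing Implicit Defensive.

Import Order.TTheory GRing.Theory Num.Theory.
Import numFieldNormedType.Exports.

Local Open Scope classical_set_scope.
Local Open Scope ring_scope.

(** * The logistic function and its iterated derivatives *)

Section logistic.
Context {R : realType}.
Implicit Types (x y t : R) (p : {poly R}).

Definition rho x : R := (1 + expR x)^-1.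

Lemma rho_gt0 x : 0 < rho x.
Proof. by rewrite invr_gt0 ltr_pwDl// expR_ge0. Qed.

Lemma rho_lt1 x : rho x < 1.
Proof. by have e0 := expR_gt0 x; rewrite invf_lt1 ?ltrDl//; lra. Qed.

Lemma rho_onto (z : R) : 0 < z < 1 -> exists x, rho x = z.
Proof.
move=> /andP[z0 z1]; exists (ln (z^-1 - 1)).
rewrite /rho lnK; first by rewrite addrC subrK invrK.
by rewrite posrE subr_gt0 invf_gt1.
Qed.

Global Instance is_derive_rho x : is_derive x 1 rho (- (rho x * (1 - rho x))).
Proof.
have e0 : 1 + expR x != 0 by rewrite gt_eqF// ltr_pwDl// expR_ge0.
have H : is_derive x (1 : R) (cst 1 + expR : R -> R) (0 + expR x).
  exact: is_deriveD.
have := @is_deriveV _ (cst 1 + expR : R -> R) x _ _ e0 H.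
rewrite [X in is_derive _ _ X _](_ : _ = rho); last by apply/funext.
move=> h; apply: is_derive_eq; rewrite /rho /= fctE /= -exprVn /GRing.scale/=.
by field.
Qed.

(* Since rho' = rho ^ 2 - rho, all derivatives of rho are polynomials in rho. *)
Definition poly_flow p : {poly R} := p^`() * ('X^2 - 'X).

Lemma is_derive_poly_rho p x :
  is_derive x 1 (fun y => p.[rho y]) (poly_flow p).[rho x].
Proof.
have := @is_derive1_comp _ (horner p) rho x _ _
  (is_derive_poly p (rho x)) (is_derive_rho x).
move=> h; apply: is_derive_eq; rewrite /poly_flow !hornerE.
by ring.
Qed.

Lemma poly_rho_bounded p : exists2 B : R, 0 <= B & forall x, `|p.[rho x]| <= B.
Proof.
elim/poly_ind: p => [|p c [B B0 hB]].
  by exists 0 => // x; rewrite horner0 normr0.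
exists (B + `|c|); first by rewrite addr_ge0.
move=> x; rewrite !hornerE (le_trans (ler_normD _ _))// lerD2r normrM.
rewrite -[leRHS]mulr1 ler_pM//.
by rewrite ger0_norm ?ltW ?rho_lt1 ?rho_gt0.
Qed.

(** Mean value theorem between 0 and [t], for either sign of [t]. It integrates the remainder bound
    once in [taylor_poly_rho]. *)
Lemma norm_bound_increment (g dg : R -> R) (C : R) (m : nat) :
  (forall t, is_derive t 1 g (dg t)) -> (forall t, `|dg t| <= C * `|t| ^+ m) ->
  0 <= C -> g 0 = 0 -> forall t, `|g t| <= C * `|t| ^+ m.+1.
Proof.
move=> dgE dgC C0 g0 t.
have cg : continuous g.
  by move=> z; apply: differentiable_continuous; apply/derivable1_diffP.
have [t0|t0] := leP 0 t.
  have [z] := MVT_segment t0 (fun x _ => dgE x) (continuous_subspaceT cg).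
  rewrite in_itv/= => /andP[z0 zt].
  rewrite g0 !subr0 => ->; rewrite normrM exprS [X in _ <= _ * X]mulrC mulrA.
  rewrite ler_wpM2r// (le_trans (dgC z))// ler_wpM2l//.
  by rewrite lerXn2r ?nnegrE//; rewrite !ger0_norm// (le_trans z0).
have [z] := MVT_segment (ltW t0) (fun x _ => dgE x) (continuous_subspaceT cg).
rewrite in_itv/= => /andP[tz z0].
rewrite g0 !sub0r => /(congr1 Num.norm); rewrite normrN => ->.
rewrite normrM normrN exprS [X in _ <= _ * X]mulrC mulrA.
rewrite ler_wpM2r// (le_trans (dgC z))// ler_wpM2l//.
by rewrite lerXn2r ?nnegrE//; rewrite !ler0_norm// ?lerN2// ltW.
Qed.

(** Induction on [m] with [p] general: the [t]-derivative of the remainder of [p] at order [m.+1] is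
    the remainder of [poly_flow p] at order [m]. Boundedness of [rho] makes [C] uniform in [y]. *)
Lemma taylor_poly_rho (m : nat) p : exists2 C : R, 0 <= C & forall y t,
  `|p.[rho (y + t)] -
    \sum_(j < m) (iter j poly_flow p).[rho y] * t ^+ j / j`!%:R| <=
  C * `|t| ^+ m.
Proof.
elim: m p => [|m IH] p.
  have [B B0 hB] := poly_rho_bounded p; exists B => // y t.
  by rewrite big_ord0 subr0 expr0 mulr1.
have [C C0 hC] := IH (poly_flow p); exists C => // y t.
pose g t := p.[rho (y + t)] -
  \sum_(j < m.+1) (iter j poly_flow p).[rho y] * t ^+ j / j`!%:R.
pose dg t := (poly_flow p).[rho (y + t)] -
  \sum_(j < m) (iter j poly_flow (poly_flow p)).[rho y] * t ^+ j / j`!%:R.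
apply: (@norm_bound_increment g dg) => // [{}t||].
  pose q := \poly_(j < m.+1) ((iter j poly_flow p).[rho y] / j`!%:R).
  have -> : g = (fun t => p.[rho (y + t)]) - horner q.
    apply/funext => s; rewrite /g !fctE horner_poly; congr (_ - _).
    by apply: eq_bigr => j _; rewrite mulrAC.
  have -> : dg t = (poly_flow p).[rho (y + t)] - q^`().[t].
    congr (_ - _); rewrite (_ : q^`() =
      \poly_(j < m) ((iter j poly_flow (poly_flow p)).[rho y] / j`!%:R)).
      by rewrite horner_poly; apply: eq_bigr => j _; rewrite mulrAC.
    apply/polyP => j; rewrite coef_deriv !coef_poly ltnS.
    case: ifP => [jm|]; last by rewrite mul0rn.
    rewrite iterSr -mulrnAr factS natrM invfM; congr (_ * _).
    by rewrite -mulr_natr mulrAC mulVf ?mul1r// pnatr_eq0.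
  apply: is_deriveB.
  have H : is_derive t (1 : R) (fun s => y + s) 1.
    have := is_deriveD (is_derive_cst y t (1 : R)) (is_derive_id t (1 : R)).
    by rewrite add0r.
  have := @is_derive1_comp _ (fun z => p.[rho z]) (fun s => y + s) t _ _
    (is_derive_poly_rho p (y + t)) H.
  by move=> h; apply: is_derive_eq; rewrite mulr1.
  exact: hC.
rewrite /g addr0 big_ord_recl/= expr0 mulr1 fact0 divr1 big1 ?addr0 ?subrr//.
by move=> j _; rewrite exprS mul0r mulr0 mul0r.
Qed.

(** [rho] takes the values 1/2, 1/3, and so on; [size p] such values would be too many roots for
    [p]. *)
Lemma poly_rho_neq0 p : p != 0 -> exists y, p.[rho y] != 0.
Proof.
move=> p0; apply/not_existsP => H.
pose s := [seq (i.+2%:R : R)^-1 | i <- iota 0 (size p)].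
have sroot : all (root p) s.
  apply/allP => z /mapP[i _ ->].
  have [|y <-] := @rho_onto (i.+2%:R^-1).
    by rewrite invr_gt0 ltr0n /= invf_lt1 ?ltr0n// ltr1n.
  by apply/negPn/negP => /(H y).
have suniq : uniq s.
  rewrite map_inj_uniq ?iota_uniq// => i j /invr_inj /eqP.
  by rewrite eqr_nat !eqSS => /eqP.
have := max_poly_roots p0 sroot suniq.
by rewrite size_map size_iota ltnn.
Qed.

(** Differentiation lowers the degree by one in characteristic zero and the factor ['X^2 - 'X]
    raises it by two. Hence no iterate is zero, and no derivative of [rho] vanishes identically. *)
Lemma size_iter_poly_flow j : size (iter j poly_flow 'X) = j.+2.
Proof.
elim: j => [|j IH]/=; first by rewrite size_polyX.
have szq : size ('X^2 - 'X : {poly R}) = 3.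
  by rewrite size_polyDl ?size_polyXn// size_polyN size_polyX.
set q := iter _ _ _ in IH *.
have szd : size q^`() = j.+1.
  rewrite /deriv; rewrite size_poly_eq IH//=.
  rewrite -mulr_natr mulf_neq0 ?pnatr_eq0//.
  by rewrite -[X in q`_X]/(j.+2.-1) -IH -lead_coefE lead_coef_eq0
    -size_poly_eq0 IH.
by rewrite /poly_flow size_mul -?size_poly_eq0 ?szd ?szq// addnC.
Qed.

Lemma iter_poly_flow_rho_neq0 j : exists y, (iter j poly_flow 'X).[rho y] != 0.
Proof. by apply: poly_rho_neq0; rewrite -size_poly_eq0 size_iter_poly_flow. Qed.

End logistic.

(** * The logistic density as a test function *)

Section logistic_integral.
Context {R : realType}.
Local Notation mu := (@lebesgue_measure R).
Implicit Types (c h t u x y : R).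

Definition psi x : R := rho x * (1 - rho x).

Lemma psi_ge0 x : 0 <= psi x.
Proof. by rewrite mulr_ge0 ?subr_ge0// ltW ?rho_gt0 ?rho_lt1. Qed.

Lemma continuous_rho : continuous (@rho R).
Proof.
by move=> x; apply: differentiable_continuous; apply/derivable1_diffP.
Qed.

Lemma continuous_psi : continuous psi.
Proof.
move=> x; apply: cvgM; first exact: continuous_rho.
by apply: cvgB; [exact: cvg_cst|exact: continuous_rho].
Qed.

Lemma measurable_psi : measurable_fun [set: R] psi.
Proof. by apply: continuous_measurable_fun; exact: continuous_psi. Qed.

Lemma rho_cvgy : rho x @[x --> +oo] --> (0 : R).
Proof.
apply: (squeeze_cvgr _ (cvg_cst 0) (@cvgr_expR R)).
near=> x; rewrite ltW ?rho_gt0//= /rho expRN lef_pV2 ?posrE ?expR_gt0//.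
by rewrite lerDr.
Unshelve. all: by end_near. Qed.

Lemma integral_psi c : (\int[mu]_(x in `[c, +oo[) (psi x)%:E = (rho c)%:E)%E.
Proof.
rewrite (@ge0_continuous_FTC2y _ _ (fun x => - rho x) _ 0).
- by rewrite EFinN oppeK add0e.
- by move=> x _; exact: psi_ge0.
- exact/continuous_subspaceT/continuous_psi.
- by rewrite -oppr0; apply: cvgN; exact: rho_cvgy.
- by move=> x _; apply: derivableN; exact: ex_derive.
- by apply: cvgN; apply: cvg_at_right_filter; exact: continuous_rho.
- move=> x _; rewrite derive1E deriveN; last exact: ex_derive.
  by rewrite derive_val opprK.
Qed.

(** Monotone convergence along the half-lines from [- n] to infinity, where the integral is
    [rho (- n)], below 1. *)
Lemma integral_psiT_le1 : (\int[mu]_x (psi x)%:E <= 1)%E.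
Proof.
have mF (i : nat) : measurable (`[(- i%:R : R), +oo[%classic : set R).
  exact: measurable_itv.
have nd : nondecreasing_seq (fun n => `[(- n%:R : R), +oo[%classic : set R).
  move=> m n mn; apply/subsetPset => x/=; rewrite !in_itv/= !andbT.
  by apply: le_trans; rewrite lerN2 ler_nat.
have mpsi i : measurable_fun (`[(- i%:R : R), +oo[%classic) (EFin \o psi).
  by apply/measurable_EFinP; apply: measurable_funTS; exact: measurable_psi.
have psi0 (i : nat) x :
    `[(- i%:R : R), +oo[%classic x -> (0 <= (EFin \o psi) x)%E.
  by move=> _; rewrite lee_fin psi_ge0.
have := ge0_nondecreasing_set_cvg_integral nd mF mpsi psi0 (mu := mu).
rewrite (_ : \bigcup_i _ = setT); last first.
  apply/seteqP; split => // x _; exists (Num.trunc `|x|).+1 => //=.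
  rewrite in_itv/= andbT lerNl (le_trans (ler_norm _))// normrN ltW//.
  by case/andP: (trunc_itv (normr_ge0 x)).
move=> /[dup] /cvg_lim <-//; move=> cv; apply: lime_le.
  by apply/cvg_ex; eexists; exact: cv.
by apply: nearW => n; rewrite integral_psi lee_fin ltW ?rho_lt1.
Qed.

Lemma integrable_psi : mu.-integrable [set: R] (EFin \o psi).
Proof.
apply/integrableP; split; first by apply/measurable_EFinP; exact: measurable_psi.
under eq_integral => x _ do rewrite /= ger0_norm ?psi_ge0//.
by rewrite (le_lt_trans integral_psiT_le1)// ltry.
Qed.

Lemma L1_measurable (f : R -> R) : L1 f -> measurable_fun [set: R] f.
Proof. by move=> fi; apply/measurable_EFinP; exact: (measurable_int mu). Qed.

Lemma measurable_rho_affine y (theta : R) :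
  measurable_fun [set: R] (fun u => rho (y + theta * u)).
Proof.
apply: measurableT_comp; first exact: continuous_measurable_fun continuous_rho.
by apply: measurable_funD => //; exact: measurable_funM.
Qed.

Lemma integrable_mul_indic (f : R -> R) (D : set R) : measurable D -> L1 f ->
  mu.-integrable [set: R] (fun x => (f x * \1_D x)%:E).
Proof.
move=> mD intf; apply: le_integrable (intf) => //.
  apply/measurable_EFinP; apply: measurable_funM; last exact: measurable_indic.
  exact: L1_measurable.
move=> x _; rewrite /= lee_fin indicE normrM.
by case: (x \in D); rewrite ?normr1 ?normr0 ?mulr1 ?mulr0.
Qed.

Lemma integral_mul_indic (f : R -> R) (D : set R) :
  (\int[mu]_x (f x * \1_D x)%:E = \int[mu]_(x in D) (f x)%:E)%E.
Proof.
rewrite [RHS]integral_mkcond; apply: eq_integral => x _.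
by rewrite patchE indicE; case: ifP; rewrite ?mulr1 ?mulr0.
Qed.

(** Fubini for [psi t * K u] on the region [u <= (t - y) / h]: the inner integral in [u] gives
    [kernel_cdf], while the one in [t] runs over [t >= y + h * u] and gives [rho]. *)
Lemma kernel_cdf_smoothing (K : R -> R) y h : L1 K -> 0 < h ->
  mu.-integrable [set: R]
    (EFin \o (fun t => psi t * kernel_cdf K ((t - y) / h))) /\
  \int[mu]_t (psi t * kernel_cdf K ((t - y) / h)) =
  \int[mu]_u (K u * rho (y + h * u)).
Proof.
move=> iK h0.
have mK := L1_measurable iK.
pose A : set (R * R) := [set z | z.2 <= (z.1 - y) / h].
have mA : measurable A.
  rewrite -[A]setTI; apply: measurable_fun_le => //.
  by apply: measurable_funM => //; exact: measurable_funB.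
have AE t u : ((t, u) \in A) = (u <= (t - y) / h) by apply/idP/idP; rewrite inE.
have AE' t u : ((t, u) \in A) = (y + h * u <= t).
  by rewrite AE ler_pdivlMr// lerBrDl mulrC.
pose g (z : R * R) := psi z.1 * (K z.2 * \1_A z).
have mg : measurable_fun [set: R * R] g.
  apply: measurable_funM.
    exact: measurableT_comp measurable_psi _.
  apply: measurable_funM; first exact: measurableT_comp mK _.
  exact: measurable_indic.
have gF t : (\int[mu]_u (g (t, u))%:E =
             (psi t * kernel_cdf K ((t - y) / h))%:E)%E.
  transitivity ((psi t)%:E *
    \int[mu]_u (K u * \1_(`]-oo, ((t - y) / h)]%classic) u)%:E)%E.
    rewrite -integralZl//; last exact: integrable_mul_indic.
  rewrite integral_mul_indic [RHS]EFinM /kernel_cdf /Rintegral fineK//.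
  by apply: integrable_fin_num => //; exact: integrableS iK.
(* The free factor [r] is [|K u|] in the integrability check and [K u] in the final equality. *)
have gG u r : (\int[mu]_t (r * (psi t * \1_A (t, u)))%:E =
             (r * rho (y + h * u))%:E)%E.
  have E t : \1_A (t, u) = \1_(`[(y + h * u), +oo[%classic) t :> R.
    rewrite !indicE AE'; congr (_%:R); congr nat_of_bool.
    by apply/idP/idP; rewrite inE/= in_itv/= andbT.
  transitivity (r%:E *
    \int[mu]_t (psi t * \1_(`[(y + h * u), +oo[%classic) t)%:E)%E.
    rewrite -integralZl//; last exact: integrable_mul_indic integrable_psi.
    by apply: eq_integral => t _; rewrite -EFinM /g/= E.
  by rewrite integral_mul_indic integral_psi.
have ig : (mu \x mu)%E.-integrable [set: R * R] (EFin \o g).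
  apply/integrable21ltyP; first exact/measurable_EFinP.
  have -> : (\int[mu]_u \int[mu]_t `|(EFin \o g) (t, u)| =
             \int[mu]_u (`|K u| * rho (y + h * u))%:E)%E.
    apply: eq_integral => u _; rewrite -gG; apply: eq_integral => t _.
    rewrite /= /g/= normrM [X in _ * X]normrM (ger0_norm (psi_ge0 _)) mulrCA.
    by rewrite [X in _ * (_ * X)]ger0_norm.
  have /integrableP[_] := iK; apply: le_lt_trans.
  apply: ge0_le_integral => //.
  - by move=> u _; rewrite lee_fin mulr_ge0// ltW ?rho_gt0.
  - apply/measurable_EFinP/measurable_funM; first exact: measurableT_comp.
    exact: measurable_rho_affine.
  - by apply: measurableT_comp => //; exact/measurable_EFinP.
  - move=> u _; rewrite lee_fin -[leRHS]mulr1 ler_wpM2l//.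
    by rewrite ltW ?rho_lt1.
have gFE : fubini_F mu (EFin \o g) =
    EFin \o (fun t => psi t * kernel_cdf K ((t - y) / h)).
  by apply/funext => t; rewrite /fubini_F /= gF.
split; first by rewrite -gFE; exact: integrable_fubini_F.
rewrite /Rintegral; congr fine.
transitivity (\int[mu]_t \int[mu]_u (EFin \o g) (t, u))%E.
  by apply: eq_integral => t _; rewrite gF.
rewrite Fubini//; apply: eq_integral => u _.
rewrite -gG; apply: eq_integral => t _; rewrite /= /g/=.
by rewrite mulrCA.
Qed.

End logistic_integral.

(** * Smoothing by a kernel of order l *)

Section kernel_expansion.
Context {R : realType}.
Local Notation mu := (@lebesgue_measure R).
Implicit Types (f g b K : R -> R) (y t u theta eps : R).

Lemma Rintegral_dominated_cvg0 (g : nat -> R -> R) b :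
  (forall n, measurable_fun [set: R] (g n)) -> L1 b ->
  (forall n u, `|g n u| <= b u) ->
  (forall u, g n u @[n --> \oo] --> 0) ->
  \int[mu]_u g n u @[n --> \oo] --> 0.
Proof.
move=> mg ib gb g0; apply: fine_cvg.
have -> : 0%:E = (\int[mu]_u (cst 0%E u))%E by rewrite integral0.
apply: (@dominated_cvg _ _ _ mu setT measurableT
    (fun n => EFin \o g n) (cst 0%E) (EFin \o b)) => //.
- by move=> n; apply/measurable_EFinP; exact: mg.
- by move=> u _; apply: cvg_EFin; [exact: nearW|exact: g0].
- by move=> n u _; rewrite /= lee_fin.
Qed.

Lemma L1_sum (n : nat) (F : 'I_n -> R -> R) : (forall i, L1 (F i)) ->
  L1 (fun u => \sum_(i < n) F i u).
Proof.
move=> iF; rewrite /L1.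
have := @integrable_sum _ _ _ mu _ measurableT _ (index_enum 'I_n) xpredT
  (fun i => EFin \o F i) (fun i _ => iF i).
by apply: eq_integrable => // u _; rewrite /= sumEFin.
Qed.

Lemma Rintegral_sum (n : nat) (F : 'I_n -> R -> R) : (forall i, L1 (F i)) ->
  \int[mu]_u (\sum_(i < n) F i u) = \sum_(i < n) \int[mu]_u F i u.
Proof.
move=> iF; rewrite /Rintegral.
under eq_integral do rewrite -sumEFin.
rewrite integral_sum//=.
rewrite (eq_bigr (fun i => (fine (\int[mu]_u (F i u)%:E))%:E)) ?sumEFin//.
by move=> i _; rewrite fineK//; apply: integrable_fin_num => //; exact: iF.
Qed.

Lemma L1_scale f (a : R) : L1 f -> L1 (fun u => a * f u).
Proof.
move=> fi; have := integrableZl measurableT a fi.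
by apply: eq_integrable => // u _; rewrite /= EFinM.
Qed.

Lemma L1_dominated f b : measurable_fun [set: R] f -> L1 b ->
  (forall u, `|f u| <= `|b u|) -> L1 f.
Proof.
move=> mf ib fb; apply: le_integrable ib => //.
  exact/measurable_EFinP.
by move=> u _; rewrite /= lee_fin.
Qed.

Lemma L1_mul_rho K y theta : L1 K -> L1 (fun u => K u * rho (y + theta * u)).
Proof.
move=> iK; apply: (L1_dominated _ iK).
  by apply: measurable_funM; [exact: L1_measurable|exact: measurable_rho_affine].
move=> u; rewrite normrM -[leRHS]mulr1 ler_wpM2l//.
by rewrite ger0_norm ltW ?rho_gt0 ?rho_lt1.
Qed.

Lemma L1_sub f g : L1 f -> L1 g -> L1 (fun u => f u - g u).
Proof.
move=> fi gi; have := integrableB measurableT fi gi.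
by apply: eq_integrable => // u _; rewrite /= EFinB.
Qed.

Lemma L1_min_linear f (C1 C2 : R) (n : nat) : L1 f -> 0 <= C1 -> 0 <= C2 ->
  L1 (fun u => `|f u| * Num.min (C1 * `|u| / n.+1%:R) C2).
Proof.
move=> fi C10 C20.
apply: (L1_dominated _ (L1_scale C2 fi)).
  apply: measurable_funM.
    by apply: measurableT_comp => //; exact: L1_measurable.
  apply: measurable_minr => //; apply: measurable_funM => //.
  by apply: measurable_funM => //; exact: measurableT_comp.
move=> u; rewrite !normrM normr_id mulrC (ger0_norm C20) ler_wpM2r//.
rewrite ger0_norm ?ge_min ?lexx ?orbT//.
by rewrite le_min C20 andbT divr_ge0// mulr_ge0.
Qed.

(** Applied to [u ^+ l * K u], whose product with [u] may fail to be integrable. The cap [C2]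
    supplies the dominating function, the linear part the pointwise limit. *)
Lemma min_linear_dominated_cvg0 f (C1 C2 : R) : L1 f -> 0 <= C1 -> 0 <= C2 ->
  \int[mu]_u (`|f u| * Num.min (C1 * `|u| / n.+1%:R) C2) @[n --> \oo] --> 0.
Proof.
move=> fi C10 C20.
apply: (@Rintegral_dominated_cvg0
  (fun n u => `|f u| * Num.min (C1 * `|u| / n.+1%:R) C2) (fun u => C2 * `|f u|)).
- by move=> n; apply: L1_measurable; exact: L1_min_linear.
- by apply: L1_scale; exact: integrable_norm.
- move=> n u; rewrite normrM normr_id mulrC ler_wpM2r//.
  rewrite ger0_norm ?ge_min ?lexx ?orbT//.
  by rewrite le_min C20 andbT divr_ge0// mulr_ge0.
- move=> u; rewrite -[X in _ --> X](mulr0 `|f u|); apply: cvgMr.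
  have h : C1 * `|u| / n.+1%:R @[n --> \oo] --> 0.
    rewrite -[X in _ --> X](mulr0 (C1 * `|u|)); apply: cvgMr.
    exact: cvg_harmonic.
  apply: (squeeze_cvgr _ (cvg_cst 0) h).
  apply: nearW => n; rewrite le_min C20 andbT ge_min lexx andbT.
  by rewrite divr_ge0// mulr_ge0.
Qed.

Lemma kernel_L1 (l : nat) K : kernel_of_order l K -> L1 K.
Proof.
case=> _ iuK _ _ _.
by apply: eq_integrable (iuK 0%N isT) => // u _; rewrite /= expr0 mul1r.
Qed.

(** Integrated against [K], the Taylor polynomial of [rho] at [y] keeps only its terms of order 0
    and [l]. The remainder bounds do not involve [y], so one [theta0] serves all [y]. *)
Lemma kernel_smoothing_expansion (l : nat) K : kernel_of_order l K ->
  forall eps, 0 < eps -> exists2 theta0, 0 < theta0 & forall theta y,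
  0 < theta <= theta0 ->
  `|\int[mu]_u (K u * rho (y + theta * u)) - rho y -
    theta ^+ l * (\int[mu]_u (u ^+ l * K u) / l`!%:R *
                  (iter l poly_flow 'X).[rho y])| <= eps * theta ^+ l.
Proof.
move=> hK eps eps0; have [l1 iuK intK uK0 _] := hK.
have iK := kernel_L1 hK.
have [C1 C10 hC1] := taylor_poly_rho l.+1 ('X : {poly R}).
have [C0 C00 hC0] := taylor_poly_rho l ('X : {poly R}).
have [B B0 hB] := poly_rho_bounded (iter l poly_flow ('X : {poly R})).
(* [C0] bounds the remainder before the term of order [l] is subtracted, [B] the coefficient of that
   term. *)
pose C2 := C0 + B.
have C20 : 0 <= C2 by rewrite addr_ge0.
(* [rem] is the remainder of order l.+1, which is small for small [t]; the bound
   [rem2] of order l is what dominates it when only [u ^+ l * K u] is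
   integrable. *)
pose c y theta (j : nat) : R :=
  (iter j poly_flow 'X).[rho y] * theta ^+ j / j`!%:R.
pose rem y t := rho (y + t) -
  \sum_(j < l.+1) (iter j poly_flow 'X).[rho y] * t ^+ j / j`!%:R.
have rem1 y t : `|rem y t| <= C1 * `|t| ^+ l.+1.
  by have := hC1 y t; rewrite hornerX.
have rem2 y t : `|rem y t| <= C2 * `|t| ^+ l.
  have := hC0 y t; rewrite hornerX /rem big_ord_recr/= opprD addrA => h.
  rewrite (le_trans (ler_normB _ _))// mulrDl lerD// -mulrA normrM.
  apply: ler_pM => //; rewrite normrM normrX ler_piMr ?exprn_ge0//.
  by rewrite ger0_norm ?invr_ge0// invf_le1 ?ler1n ?ltr0n fact_gt0.
(* For [theta <= N.+1%:R^-1] the remainder divided by [theta ^+ l] is dominated by the capped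
   integrand of index [N]; this fixes [theta0]. *)
have /cvgr_lt/(_ _ eps0) [N _ /(_ N (leqnn N))/= hN] :=
  min_linear_dominated_cvg0 (iuK l (leqnn l)) C10 C20.
exists N.+1%:R^-1; first by rewrite invr_gt0.
move=> theta y /andP[th0 thN].
pose S u := \sum_(j < l.+1) c y theta j * (u ^+ j * K u).
have iS : L1 S.
  by apply: L1_sum => j; apply: L1_scale; apply: iuK; rewrite -ltnS.
have remE u : K u * rem y (theta * u) = K u * rho (y + theta * u) - S u.
  rewrite /rem mulrBr; congr (_ - _); rewrite mulr_sumr; apply: eq_bigr => j _.
  by rewrite exprMn /c; ring.
have irem : L1 (fun u => K u * rem y (theta * u)).
  by under eq_fun do rewrite remE; apply: L1_sub => //; exact: L1_mul_rho.
have remG u : `|K u * rem y (theta * u)| <= theta ^+ l *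
    (`|u ^+ l * K u| * Num.min (C1 * `|u| / N.+1%:R) C2).
  have -> : theta ^+ l * (`|u ^+ l * K u| * Num.min (C1 * `|u| / N.+1%:R) C2) =
      `|K u| * ((theta ^+ l * `|u| ^+ l) * Num.min (C1 * `|u| / N.+1%:R) C2).
    by rewrite normrM normrX; ring.
  rewrite normrM ler_wpM2l//.
  have tu0 : 0 <= theta ^+ l * `|u| ^+ l by rewrite mulr_ge0 ?exprn_ge0// ltW.
  have tuE : `|theta * u| = theta * `|u| by rewrite normrM gtr0_norm.
  rewrite minr_pMr// le_min; apply/andP; split.
    apply: (le_trans (rem1 _ _)).
    rewrite tuE !exprS.
    have -> : C1 * (theta * `|u| * (theta * `|u|) ^+ l) =
        theta ^+ l * `|u| ^+ l * (C1 * `|u|  * theta) by rewrite exprMn; ring.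
    by rewrite ler_wpM2l// ler_wpM2l// mulr_ge0.
  by apply: (le_trans (rem2 _ _)); rewrite tuE exprMn mulrC.
have intS : \int[mu]_u S u = rho y +
    theta ^+ l * (\int[mu]_u (u ^+ l * K u) / l`!%:R *
                  (iter l poly_flow 'X).[rho y]).
  rewrite Rintegral_sum; last first.
    by move=> j; apply: L1_scale; apply: iuK; rewrite -ltnS.
  under eq_bigr => j _.
    rewrite RintegralZl//; last by apply: iuK; rewrite -ltnS.
    over.
  (* With [l] a successor, the two surviving terms are the first and the last of the sum and can be
     split off. *)
  case: (l) l1 uK0 => // k _ uk0.
  rewrite big_ord_recr big_ord_recl big1 /=; last first.
    by move=> j _; rewrite uk0 ?mulr0// /bump leq0n add1n /= ltnS ltn_ord.
  rewrite /c/= fact0 divr1 expr0 mulr1 addr0; congr (_ + _).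
    by rewrite hornerX; under eq_Rintegral do rewrite mul1r; rewrite intK mulr1.
  by rewrite [RHS]mulrCA; ring.
have -> : \int[mu]_u (K u * rho (y + theta * u)) =
    \int[mu]_u S u + \int[mu]_u (K u * rem y (theta * u)).
  rewrite -RintegralD//; apply: eq_Rintegral => u _.
  by rewrite remE addrCA subrr addr0.
rewrite intS addrAC -!addrA.
rewrite [X in `|X|](_ : _ = \int[mu]_u (K u * rem y (theta * u))); last by ring.
have iG := L1_min_linear N (iuK l (leqnn l)) C10 C20.
apply: (le_trans (le_normr_Rintegral measurableT irem)).
have : \int[mu]_u `|K u * rem y (theta * u)| <=
    \int[mu]_u (theta ^+ l *
      (`|u ^+ l * K u| * Num.min (C1 * `|u| / N.+1%:R) C2)).
  apply: le_Rintegral => //.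
  - exact: integrable_norm irem.
  - exact: L1_scale.
move/le_trans; apply; rewrite RintegralZl// mulrC ler_wpM2r ?exprn_ge0 ?ltW//.
Qed.

End kernel_expansion.

(** * From a uniform deviation bound to a bound on the bandwidth *)

Section deterministic.
Context {R : realType}.
Local Notation mu := (@lebesgue_measure R).
Implicit Types (K : R -> R) (x : nat -> R) (h t S : R).

Lemma norm_average_le (n : nat) (F : 'I_n -> R) (b : R) : 0 <= b ->
  (forall i, `|F i| <= b) -> `|n%:R^-1 * \sum_(i < n) F i| <= b.
Proof.
move=> b0 Fb; case: n F Fb => [|n] F Fb; first by rewrite big_ord0 mulr0 normr0.
rewrite normrM gtr0_norm ?invr_gt0 ?ltr0n// ler_pdivrMl ?ltr0n//.
rewrite (le_trans (ler_norm_sum _ _ _))//.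
rewrite (le_trans (ler_sum _ (fun i _ => Fb i)))//.
by rewrite sumr_const card_ord mulr_natl.
Qed.

(** Counterpart of [kernel_cdf_smoothing] for the unsmoothed jump of one observation. *)
Lemma psi_step_integral (y : R) : L1 (fun t => psi t * ((y <= t)%R)%:R) /\
  \int[mu]_t (psi t * ((y <= t)%R)%:R) = rho y.
Proof.
have E : (fun t => psi t * ((y <= t)%R)%:R) =
    (fun t => psi t * \1_(`[y, +oo[%classic) t).
  apply/funext => t; rewrite indicE.
  have -> // : (t \in `[y, +oo[%classic) = (y <= t).
  by apply/idP/idP; rewrite inE/= in_itv/= andbT.
rewrite E; split.
  by apply: integrable_mul_indic => //; exact: integrable_psi.
by rewrite /Rintegral integral_mul_indic integral_psi.
Qed.

(** Integration against [psi] does not enlarge a uniform bound, since [psi] has mass at most 1. By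
    the two integral identities, the average is minus the tested deviation. *)
Lemma tested_deviation K (n : nat) x h S : L1 K -> 0 < h ->
  (forall t, `|ecdf x n t - smoothed_ecdf K x n h t| <= S) ->
  `|n%:R^-1 * \sum_(i < n)
      (\int[mu]_u (K u * rho (x i + h * u)) - rho (x i))| <= S.
Proof.
move=> iK h0 hS.
have S0 : 0 <= S by exact: le_trans (normr_ge0 _) (hS 0).
pose F (i : 'I_n) t := psi t * ((x i <= t)%R)%:R -
                       psi t * kernel_cdf K ((t - x i) / h).
have iF i : L1 (F i).
  apply: L1_sub; first by have [] := psi_step_integral (x i).
  by have [] := kernel_cdf_smoothing (x i) iK h0.
have intF i : \int[mu]_t F i t =
    rho (x i) - \int[mu]_u (K u * rho (x i + h * u)).
  have [i1 e1] := psi_step_integral (x i).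
  have [i2 e2] := kernel_cdf_smoothing (x i) iK h0.
  by rewrite RintegralB// e1 e2.
pose G t := n%:R^-1 * \sum_(i < n) F i t.
have iG : L1 G by apply: L1_scale; exact: L1_sum.
have GE t : G t = psi t * (ecdf x n t - smoothed_ecdf K x n h t).
  rewrite /G /ecdf /smoothed_ecdf -mulrBr -sumrB mulrCA; congr (_ * _).
  by rewrite mulr_sumr; apply: eq_bigr => i _; rewrite mulrBr.
have -> : n%:R^-1 * \sum_(i < n)
    (\int[mu]_u (K u * rho (x i + h * u)) - rho (x i)) = - \int[mu]_t G t.
  rewrite RintegralZl//; last exact: L1_sum.
  rewrite Rintegral_sum// -mulrN -sumrN; congr (_ * _).
  by apply: eq_bigr => i _; rewrite intF opprB.
rewrite normrN (le_trans (le_normr_Rintegral measurableT iG))//.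
have : \int[mu]_t `|G t| <= \int[mu]_t (S * psi t).
  apply: le_Rintegral => //.
  - exact: integrable_norm.
  - by apply: L1_scale; exact: integrable_psi.
  - move=> t _; rewrite GE normrM mulrC (ger0_norm (psi_ge0 _)).
    by rewrite ler_wpM2r ?psi_ge0.
move=> /le_trans; apply; rewrite RintegralZl//; last exact: integrable_psi.
rewrite -[leRHS]mulr1 ler_wpM2l// -lee_fin /Rintegral fineK//.
  exact: integral_psiT_le1.
by apply: integrable_fin_num => //; exact: integrable_psi.
Qed.

(** Together with [smoothed_ecdf_affine], this carries a uniform deviation bound over to the
    contracted sample with bandwidth [h / lam]. *)
Lemma ecdf_affine (n : nat) x (lam y t : R) : 0 < lam ->
  ecdf (fun i => x i / lam + y) n t = ecdf x n (lam * (t - y)).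
Proof.
move=> lam0; rewrite /ecdf; congr (_ * _); apply: eq_bigr => i _.
by rewrite -lerBrDr ler_pdivrMr// [in RHS]mulrC.
Qed.

Lemma smoothed_ecdf_affine K (n : nat) x h (lam y t : R) : 0 < lam ->
  smoothed_ecdf K (fun i => x i / lam + y) n (h / lam) t =
  smoothed_ecdf K x n h (lam * (t - y)).
Proof.
move=> lam0; rewrite /smoothed_ecdf; congr (_ * _); apply: eq_bigr => i _.
congr kernel_cdf; rewrite invf_div mulrA; congr (_ / h).
rewrite mulrC mulrBr mulrBr mulrDr mulrCA divff ?gt_eqF// mulr1.
by rewrite opprD addrAC addrA addrAC.
Qed.

(** Every index contributes at most [a / 4]; the hits, a proportion below 1/N, add at most B/N,
    which is again at most [a / 4]. *)
Lemma average_near (n N : nat) (F : 'I_n -> R) (hit : pred 'I_n) (q a B : R) :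
  (N * #|hit| < n)%N -> 0 < a -> 0 <= B -> 4 * B <= N%:R * a ->
  (forall i, `|F i - q| <= a / 4 + B * (hit i)%:R) ->
  `|n%:R^-1 * \sum_(i < n) F i - q| <= a / 2.
Proof.
move=> Nn a0 B0 BN hF.
have n0 : (0 : R) < n%:R by rewrite ltr0n (leq_ltn_trans _ Nn).
have -> : n%:R^-1 * \sum_(i < n) F i - q = n%:R^-1 * \sum_(i < n) (F i - q).
  rewrite sumrB mulrBr sumr_const card_ord -[q *+ n]mulr_natl mulrA.
  by rewrite mulVf ?gt_eqF// mul1r.
rewrite normrM gtr0_norm ?invr_gt0// ler_pdivrMl//.
rewrite (le_trans (ler_norm_sum _ _ _))//.
rewrite (le_trans (ler_sum _ (fun i _ => hF i)))//.
rewrite big_split/= sumr_const card_ord -mulr_sumr -natr_sum.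
have -> : (\sum_(i < n) hit i = #|hit|)%N.
  by rewrite -sum1_card [RHS]big_mkcond/=; apply: eq_bigr => i _;
    rewrite unfold_in; case: (hit i).
set k := #|_| in Nn *.
have kn : N%:R * k%:R <= n%:R :> R by rewrite -natrM ler_nat ltnW.
rewrite -mulr_natl.
have : 4 * B * k%:R <= a * n%:R.
  rewrite (le_trans (ler_wpM2r _ BN))// mulrAC mulrC ler_wpM2l// ltW//.
lra.
Qed.

(** [N] precedes [M] because the tolerated proportion of outliers depends only on the derivative of
    [rho] of order [l]; [M] can then be chosen from the law of the sample. *)
Lemma bandwidth_bound (l : nat) K : kernel_of_order l K ->
  exists N : nat, forall M : R, exists C S0 : R, [/\ 0 < C, 0 < S0 &
  forall (n : nat) x h S,
    (N * #|[pred i : 'I_n | (M < `|x i|)%R]| < n)%N -> 0 < h ->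
    (forall t, `|ecdf x n t - smoothed_ecdf K x n h t| <= S) ->
    S < S0 -> h ^+ l <= C * S].
Proof.
move=> hK.
have iK := kernel_L1 hK.
pose kap : R := \int[mu]_u (u ^+ l * K u) / l`!%:R.
have kap0 : 0 < `|kap|.
  rewrite normr_gt0 mulf_neq0 ?invr_eq0 ?pnatr_eq0 -?lt0n ?fact_gt0//.
  by case: hK.
pose q (y : R) : R := (iter l poly_flow 'X).[rho y].
have [y0 qy0] : exists y, q y != 0 := iter_poly_flow_rho_neq0 l.
have [B B0 qB] := poly_rho_bounded (iter l (@poly_flow R) 'X).
pose a : R := `|q y0|.
have a0 : 0 < a by rewrite normr_gt0.
have cq : {for y0, continuous q}.
  apply: differentiable_continuous; apply/derivable1_diffP.
  exact: (@ex_derive _ _ _ _ _ _ _ (is_derive_poly_rho _ _)).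
have /cvgr_dist_le/(_ (a / 4)) := cq.
have a40 : 0 < a / 4 by rewrite divr_gt0.
move=> /(_ a40) /nbhs_ballP [r /= r0 hr].
(* The main term will be at least [2 * eps * (h / lam) ^+ l]; the remainder uses up one [eps] and
   the other bounds [S] from below. *)
pose eps : R := `|kap| * a / 4.
have eps0 : 0 < eps by rewrite divr_gt0// mulr_gt0.
have [th0 th00 hexp] := kernel_smoothing_expansion hK eps0.
(* An outlier changes [q] by at most [B + a], so [average_near] asks for
   [4 * (B + a) <= N%:R * a]. *)
exists (Num.trunc (4 * (B + a) / a)).+1 => M.
(* Contraction by [lam0] or more sends every point of norm at most [M] into the ball of radius [r]
   around [y0], where [q] is within [a / 4] of [q y0]. *)
pose lam0 : R := (`|M| + 1) / r.
have lam00 : 0 < lam0 by rewrite divr_gt0// ltr_pwDr.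
(* [C] is read off from [key] at [lam0]; [S0] is the lower bound that [key] gives at [h / th0],
   where the rescaled bandwidth is [th0]. *)
exists (lam0 ^+ l / eps), (th0 ^+ l * eps); split.
- by rewrite divr_gt0// exprn_gt0.
- by rewrite mulr_gt0// exprn_gt0.
move=> n x h S hits h0 hS SS0.
(* Rescaling the sample and the bandwidth by [lam] leaves the deviation
   unchanged; [lam0] serves for small [h], and [lam = h / th0] excludes large
   [h]. *)
have key lam : lam0 <= lam -> h <= th0 * lam -> (h / lam) ^+ l * eps <= S.
  move=> lam0le hlam.
  have lamp : 0 < lam by exact: lt_le_trans lam0le.
  have hp : 0 < h / lam by rewrite divr_gt0.
  pose x' i := x i / lam + y0.
  have hS' t : `|ecdf x' n t - smoothed_ecdf K x' n (h / lam) t| <= S.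
    by rewrite ecdf_affine// smoothed_ecdf_affine.
  have h1 := tested_deviation iK hp hS'.
  set A := n%:R^-1 * _ in h1.
  pose Q : R := n%:R^-1 * \sum_(i < n) q (x' i).
  have h2 : `|A - (h / lam) ^+ l * (kap * Q)| <= eps * (h / lam) ^+ l.
    have -> : A - (h / lam) ^+ l * (kap * Q) = n%:R^-1 * \sum_(i < n)
        (\int[mu]_u (K u * rho (x' i + h / lam * u)) - rho (x' i) -
        (h / lam) ^+ l * (kap * q (x' i))).
      rewrite sumrB mulrBr; congr (_ - _).
      by rewrite /Q -!mulr_sumr; ring.
    apply: norm_average_le => [|i]; first by rewrite mulr_ge0 ?exprn_ge0// ltW.
    by apply: hexp; rewrite hp ler_pdivrMr.
  have h3 : `|Q - q y0| <= a / 2.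
    apply: (average_near hits a0 (addr_ge0 B0 (ltW a0))).
      rewrite -ler_pdivrMr// ltW//.
      have : 0 <= 4 * (B + a) / a by rewrite divr_ge0 ?mulr_ge0 ?addr_ge0 // ltW.
      by move/trunc_itv/andP => [].
    move=> i /=; have [Mx|xM] := ltP M `|x i|.
      rewrite mulr1 (le_trans (ler_normB _ _))//.
      by rewrite (le_trans (lerD (qB _) (lexx _)))// lerDr ltW.
    rewrite mulr0 addr0 distrC; apply: hr.
    rewrite /ball/= /x' opprD addrCA subrr addr0.
    rewrite normrN normrM normfV (gtr0_norm lamp) ltr_pdivrMr//.
    rewrite (le_lt_trans xM)// (le_lt_trans (ler_norm _))//.
    apply: (@lt_le_trans _ _ (r * lam0)); last by rewrite ler_pM2l.
    by rewrite /lam0 mulrCA divff ?gt_eqF// mulr1 ltrDl.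
  have h4 : a / 2 <= `|Q|.
    have : a <= `|Q - q y0| + `|Q|.
      by rewrite /a -{1}[q y0](subrK Q) (le_trans (ler_normD _ _))// distrC.
    lra.
  have h5 : (h / lam) ^+ l * (`|kap| * `|Q|) <= S + eps * (h / lam) ^+ l.
    rewrite -!normrM -[X in X * _](ger0_norm (exprn_ge0 l (ltW hp))) -normrM.
    rewrite -[X in `|X|](subrK A); rewrite addrC (le_trans (ler_normD _ _))//.
    by rewrite lerD// distrC.
  have h6 : (h / lam) ^+ l * (`|kap| * (a / 2)) <=
      (h / lam) ^+ l * (`|kap| * `|Q|).
    apply: ler_wpM2l; first by rewrite exprn_ge0// ltW.
    by apply: ler_wpM2l => //; exact: ltW.
  move: h5 h6; rewrite /eps.
  set T := (h / lam) ^+ l; set u := `|kap|; nra.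
have [hle|hgt] := leP h (th0 * lam0).
  have := key lam0 (lexx _) hle.
  rewrite expr_div_n mulrAC ler_pdivrMr ?exprn_gt0// => ?.
  by rewrite mulrAC ler_pdivlMr// [leRHS]mulrC.
exfalso; have := key (h / th0); rewrite ler_pdivlMr// [lam0 * _]mulrC ltW//.
rewrite [th0 * _]mulrC divfK ?gt_eqF// => /(_ isT (lexx _)).
have -> : h / (h / th0) = th0.
  by rewrite invf_div mulrCA divff ?mulr1// gt_eqF.
by rewrite leNgt SS0.
Qed.

End deterministic.

(** * Almost sure tightness of the sample *)

Section tightness.
Context {disp : measure_display} {T : measurableType disp} {R : realType}
  {P : probability T R}.
Implicit Type X : nat -> {RV P >-> R}.

Lemma measure_bigsetU_le (I : Type) (s : seq I) (F : I -> set T) :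
  (forall i, measurable (F i)) ->
  (P (\big[setU/set0]_(i <- s) F i) <= \sum_(i <- s) P (F i))%E.
Proof.
move=> mF; elim: s => [|i s IH]; first by rewrite !big_nil measure0.
rewrite !big_cons (le_trans (measureU2 _ _ _))//.
  exact: bigsetU_measurable.
by rewrite leeD2l.
Qed.

Lemma card_finset_ord (n : nat) : #|{set 'I_n}| = (2 ^ n)%N.
Proof. by rewrite -cardsT -powersetT card_powerset cardsT card_ord. Qed.

Lemma measurable_norm_gt (M : R) : measurable [set x : R | (M < `|x|)%R].
Proof.
have -> : [set x : R | (M < `|x|)%R] = ~` [set x : R | (`|x| <= M)%R].
  by apply/seteqP; split => x /=; rewrite ltNge => /negP.
apply: measurableC; rewrite -[X in measurable X]setTI.
by apply: measurable_fun_le => //; exact: measurable_normr.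
Qed.

Lemma measurable_preimage_RV (Y : {RV P >-> R}) (B : set R) :
  measurable B -> measurable (Y @^-1` B).
Proof.
move=> mB; rewrite -[X in measurable X]setTI.
exact: (measurable_funPT Y measurableT).
Qed.

(** Continuity from above along the events that [|X 0|] exceeds [m], which decrease to the empty
    set. *)
Lemma tail_small X (eps : R) : 0 < eps ->
  exists M : R, (P (X 0%N @^-1` [set x | (M < `|x|)%R]) < eps%:E)%E.
Proof.
move=> eps0.
pose F (m : nat) := X 0%N @^-1` [set x | (m%:R < `|x|)%R].
have mF m : measurable (F m).
  by apply: measurable_preimage_RV; exact: measurable_norm_gt.
have F0 : \bigcap_m F m = set0.
  apply/seteqP; split=> // w /(_ (Num.trunc `|X 0%N w|).+1 I); rewrite /F/=.
  have /trunc_itv/andP[_] := normr_ge0 (X 0%N w).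
  by move=> /ltW; rewrite leNgt => /negP.
have := @nonincreasing_cvg_mu _ _ _ P F _ mF.
rewrite F0 measure0 => /(_ _ _ _)/fine_cvg/cvgr_lt => /(_ _ _ _ eps eps0).
case => //.
- by rewrite (le_lt_trans (probability_le1 _ _))// ltry.
- move=> m n mn; apply/subsetPset => w; rewrite /F/=; apply: le_lt_trans.
  by rewrite ler_nat.
move=> N _ /(_ N (leqnn N))/= hN; exists N%:R.
rewrite -[X in (X < _)%E]fineK ?lte_fin//; apply: fin_num_measure; exact: (mF N).
Qed.

Lemma all_hits_prob X (B : set R) (n : nat) (J : {set 'I_n}) (p : R) :
  iid X -> measurable B -> P (X 0%N @^-1` B) = p%:E ->
  P (\bigcap_(i in [set i : nat | exists2 j : 'I_n, j \in J & i = j])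
       (X i @^-1` B)) =
  (p ^+ #|J|)%:E.
Proof.
move=> [indX idX] mB hp.
(* Independence speaks of finite sets of naturals, so [J] is transported along the injection
   [val]. *)
pose J' := [fset x in [seq val j | j <- enum J]]%fset.
have := indX J' (fun=> B) (fun=> mB).
rewrite (_ : [set` J'] =
    [set i : nat | exists2 j : 'I_n, j \in J & i = j]); last first.
  apply/seteqP; split => i /=; rewrite !inE.
    by move=> /mapP[j]; rewrite mem_enum => jJ ->; exists j.
  by move=> [j jJ ->]; apply/mapP; exists j; rewrite ?mem_enum.
move=> ->; rewrite (eq_bigr (fun=> p%:E)); last first.
  by move=> i _; rewrite -hp; exact: idX.
have -> : #|J| = #|` J'|.
  rewrite /J' card_fseq undup_id ?size_map -?cardE//.
  by rewrite map_inj_uniq ?enum_uniq//; exact: val_inj.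
rewrite big_const_seq count_predT.
by elim: (size _) => //= k ->; rewrite exprS EFinM.
Qed.

(** Borel-Cantelli. The tail level [4^-1 ^+ N] is small enough that n/N simultaneous hits are rarer
    than the [2 ^ n] index sets are numerous. *)
Lemma ae_eventually_few_hits X (N : nat) : iid X -> exists M : R,
  {ae P, forall w, \forall n \near \oo,
    (N * #|[pred i : 'I_n | (M < `|X i w|)%R]| < n)%N}.
Proof.
move=> iidX; have e0 : (0 : R) < 4^-1 ^+ N by rewrite exprn_gt0// invr_gt0.
have [M hM] := tail_small X e0; exists M.
pose B := [set x : R | (M < `|x|)%R].
have mB : measurable B by exact: measurable_norm_gt.
pose p : R := fine (P (X 0%N @^-1` B)).
have pE : P (X 0%N @^-1` B) = p%:E
  by rewrite fineK// fin_num_measure//; exact: measurable_preimage_RV.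
have p0 : 0 <= p by rewrite fine_ge0.
have p4 : p <= 4^-1 ^+ N by rewrite -lee_fin -pE ltW.
(* Union bound: the event that at least n / N of the n observations are hits is
   covered by at most 2 ^ n events [A n J], each of probability at most
   p ^ #|J| <= 4 ^ - n. *)
pose A n (J : {set 'I_n}) : set T := if (n <= N * #|J|)%N then
  \bigcap_(i in [set i : nat | exists2 j : 'I_n, j \in J & i = j]) (X i @^-1` B)
  else set0.
have mA n (J : {set 'I_n}) : measurable (A n J).
  rewrite /A; case: ifP => // _; apply: bigcap_measurableType => i _.
  exact: measurable_preimage_RV.
have PA n (J : {set 'I_n}) : (P (A n J) <= (4^-1 ^+ n)%:E)%E.
  rewrite /A; case: ifP => [nJ|_]; last by rewrite measure0 lee_fin exprn_ge0.
  rewrite (all_hits_prob _ iidX mB pE) lee_fin.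
  rewrite (@le_trans _ _ ((4^-1 ^+ N) ^+ #|J|))//.
    by rewrite lerXn2r// nnegrE ltW.
  by rewrite -exprM ler_wiXn2l// invf_le1// ler1n.
pose U n := \big[setU/set0]_(J <- index_enum {set 'I_n}) A n J.
have mU n : measurable (U n) by exact: bigsetU_measurable.
(* The bound is 1/2^n, written as a term of the geometric series summed below. *)
have PU n : (P (U n) <= (2 / (2 ^ (n + 1))%:R)%:E)%E.
  rewrite (le_trans (measure_bigsetU_le _ (mA n)))//.
  rewrite (@le_trans _ _ (\sum_(J <- index_enum {set 'I_n}) (4^-1 ^+ n)%:E)%E)//.
    by apply: lee_sum => J _; exact: PA.
  rewrite sumEFin lee_fin sumr_const card_finset_ord -[leLHS]mulr_natl !natrX.
  rewrite -exprMn exprD expr1 invfM mulrCA divff// mulr1 -exprVn.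
  by have -> : 2 / 4 = 2^-1 :> R by field.
have sumU : (\sum_(n <oo) P (U n) < +oo)%E.
  apply: le_lt_trans
    (lee_nneseries (fun _ _ _ => measure_ge0 _ _) (fun n _ => PU n)) _.
  by rewrite (cvg_lim _ (@cvg_geometric_eseries_half R 2 0))// ltry.
have := lim_sup_set_cvg0 mU sumU => h0.
exists (lim_sup_set U); split => //.
  apply: bigcapT_measurable => n; apply: bigcup_measurable => k _; exact: mU.
move=> w /= hw n _; apply: contrapT => hU; apply: hw.
exists n => // m /= nm; rewrite ltnNge; apply/negP => hits.
apply: hU; exists m => //; rewrite /U -bigcup_seq /=.
(* The set of all actual hits at [w] is the [J] whose event contains [w]. *)
exists [set i : 'I_m | (M < `|X i w|)%R]%SET => /=.
  by rewrite mem_index_enum.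
rewrite /A cardsE hits => i [j]; rewrite inE => hj ->; exact: hj.
Qed.

End tightness.

(** * Distances and rates *)

Section distances.
Context {R : realType}.
Local Notation mu := (@lebesgue_measure R).
Implicit Types (K : R -> R) (x : nat -> R) (h t S a b : R) (F G : R -> R).

(** Dominated convergence under [|K u|]: each [u] eventually lies outside the receding half-line. *)
Lemma kernel_cdf_cvgNy K (c h : R) : L1 K -> 0 < h ->
  kernel_cdf K ((- m%:R - c) / h) @[m --> \oo] --> 0.
Proof.
move=> iK h0.
have E (m : nat) : kernel_cdf K ((- m%:R - c) / h) =
    \int[mu]_u (K u * \1_(`]-oo, ((- m%:R - c) / h)]%classic) u).
  by rewrite /Rintegral integral_mul_indic.
rewrite (funext E); apply: (Rintegral_dominated_cvg0 (b := fun u => `|K u|)).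
- move=> m; apply: measurable_funM; first exact: L1_measurable.
  exact: measurable_indic.
- exact: integrable_norm.
- move=> m u; rewrite normrM indicE; case: (_ \in _).
    by rewrite normr1 mulr1.
  by rewrite normr0 mulr0.
- move=> u; apply: cvg_near_cst; near=> m.
  rewrite indicE memNset ?mulr0//= in_itv/= ler_pdivlMr// lerBrDr.
  apply/negP; rewrite -ltNge ltrNl; near: m; exact: nbhs_infty_gtr.
Unshelve. all: by end_near. Qed.

Lemma average_cvg0 (n : nat) (u : 'I_n -> nat -> R) :
  (forall i, u i m @[m --> \oo] --> 0) ->
  n%:R^-1 * (\sum_(i < n) u i m) @[m --> \oo] --> 0.
Proof.
move=> u0; rewrite -[X in _ --> X](mulr0 n%:R^-1); apply: cvgMr.
elim: (index_enum 'I_n) => [|i r IH].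
  by under eq_fun do rewrite big_nil; exact: cvg_cst.
rewrite (_ : (fun m => _) = (u i \+ (fun m => \sum_(j <- r) u j m))).
  by rewrite -[X in _ --> X](addr0 0); exact: cvgD.
by apply/funext => m; rewrite big_cons.
Qed.

Lemma ecdf_cvgNy x (n : nat) : ecdf x n (- m%:R) @[m --> \oo] --> 0.
Proof.
apply: average_cvg0 => i; apply: cvg_near_cst; near=> m.
rewrite leNgt ltrNl; apply/eqP; rewrite pnatr_eq0 eqb0 negbK.
by near: m; exact: nbhs_infty_gtr.
Unshelve. all: by end_near. Qed.

Lemma smoothed_ecdf_cvgNy K x (n : nat) h : L1 K -> 0 < h ->
  smoothed_ecdf K x n h (- m%:R) @[m --> \oo] --> 0.
Proof.
by move=> iK h0; apply: average_cvg0 => i; exact: kernel_cdf_cvgNy.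
Qed.

Lemma d_infty_le F G S t : d_infty F G = S%:E -> `|F t - G t| <= S.
Proof. by move=> dS; rewrite -lee_fin -dS; apply: ereal_sup_ubound; exists t. Qed.

Lemma d_kuip_le (k : nat) F G S a b : (1 <= k)%N -> d_kuip k F G = S%:E ->
  a <= b -> `|(F b - G b) - (F a - G a)| <= S.
Proof.
case: k => // k _ dS ab; rewrite -lee_fin -dS; apply: ereal_sup_ubound.
(* All intervals but the first are reduced to the point [b]. *)
exists (fun i => if i is 0%N then a else b), (fun=> b); split.
  by split=> [[|i]|[|i]].
congr EFin; rewrite big_ord_recl/= big1 ?addr0; first by congr `|_|; ring.
by move=> i _; rewrite !subrr normr0.
Qed.

(** A Kuiper distance controls increments only. Both functions vanish at minus infinity, so the
    increment from a remote [- m%:R] to [t] gives the deviation at [t] up to [e]. *)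
Lemma d_kuip_sup_le (k : nat) K x (n : nat) h S t : (1 <= k)%N ->
  L1 K -> 0 < h -> d_kuip k (ecdf x n) (smoothed_ecdf K x n h) = S%:E ->
  `|ecdf x n t - smoothed_ecdf K x n h t| <= S.
Proof.
move=> k1 iK h0 dS; apply/ler_addgt0Pr => e e0.
pose D t := ecdf x n t - smoothed_ecdf K x n h t.
have D0 : D (- m%:R) @[m --> \oo] --> 0.
  rewrite -[X in _ --> X](subr0 0).
  by apply: cvgB; [exact: ecdf_cvgNy|exact: smoothed_ecdf_cvgNy].
near \oo => m.
have mt : - m%:R <= t.
  by rewrite lerNl; near: m; exact: nbhs_infty_ger.
have De : `|D (- m%:R)| <= e.
  by near: m; apply: (cvgr_norm_le 0) => //; rewrite normr0.
rewrite -/(D t) -[D t](subrK (D (- m%:R))).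
rewrite (le_trans (ler_normD _ _))// lerD//.
exact: d_kuip_le k1 dS mt.
Unshelve. all: by end_near. Qed.

(** Since ln y < y, ln ln n < ln n = 2 ln(sqrt n) < 2 sqrt n, and sqrt n eventually exceeds [2 / c].
    The sign, valid from n >= e on, makes the roots in [powR_rate] genuine. *)
Lemma ln_ln_div_small (c : R) : 0 < c ->
  \forall n \near \oo, 0 <= ln (ln n%:R : R) /\ ln (ln n%:R) / n%:R < c.
Proof.
move=> c0; near=> n.
have ne : expR 1 <= n%:R :> R by near: n; exact: nbhs_infty_ger.
have n0 : (0 : R) < n%:R by rewrite (lt_le_trans _ ne)// expR_gt0.
have ln1 : 1 <= ln n%:R :> R.
  by rewrite -[leLHS]expRK ler_ln// posrE expR_gt0.
split; first exact: ln_ge0.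
have sn0 : 0 < Num.sqrt n%:R :> R by rewrite sqrtr_gt0.
have sn : Num.sqrt n%:R * Num.sqrt n%:R = n%:R :> R.
  by rewrite -expr2 sqr_sqrtr// ltW.
have l1 : ln (ln n%:R) < ln n%:R :> R.
  by apply: ln_sublinear; rewrite (lt_le_trans _ ln1).
have l2 : ln n%:R < 2 * Num.sqrt n%:R :> R.
  by rewrite -{1}sn lnM ?posrE//; have := ln_sublinear sn0; lra.
have cn : 2 / c < Num.sqrt n%:R.
  have : (2 / c) ^+ 2 < n%:R by near: n; exact: nbhs_infty_gtr.
  rewrite -[X in _ < X -> _]sn -expr2 ltr_pXn2r// ?nnegrE ?sqrtr_ge0//.
  by rewrite divr_ge0// ltW.
rewrite ltr_pdivrMr// (lt_trans l1)// (lt_trans l2)//.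
rewrite -[X in c * X]sn mulrA ltr_pM2r//.
by move: cn; rewrite ltr_pdivrMr// mulrC.
Unshelve. all: by end_near. Qed.

(** The power [l] turns the exponents 1/(2l) into square roots, which matches the claimed rate with
    that of [s]. *)
Lemma powR_rate (l n : nat) : (1 <= l)%N -> (0 < n)%N -> 0 <= ln (ln n%:R : R) ->
  (n%:R `^ (- (2 * l)%:R^-1) * (ln (ln n%:R)) `^ ((2 * l)%:R^-1)) ^+ l =
  Num.sqrt (ln (ln n%:R) / n%:R) :> R.
Proof.
move=> l1 n0 L0.
have root (y : R) : 0 <= y -> (y `^ ((2 * l)%:R^-1)) ^+ l = Num.sqrt y.
  move=> y0; rewrite -powR_mulrn ?powR_ge0// -powRrM -powR12_sqrt//.
  by rewrite natrM invfM -mulrA mulVf ?mulr1// pnatr_eq0 -lt0n.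
by rewrite exprMn powRN exprVn !root// sqrtrM// sqrtrV// mulrC.
Qed.

End distances.

(** * Almost sure rate of the selected bandwidth *)

Theorem theorem3p1 (R : realType) (disp : measure_display)
    (T : measurableType disp) (P : probability T R)
    (l : nat) (hl : (2 <= l)%N)
    (K : R -> R) (hK : kernel_of_order l K)
    (X : nat -> {RV P >-> R}) (hX : iid X)
    (f : R -> R) (hf : sobolev1 l f)
    (hXf : forall i : nat, has_density (X i) f)
    (d : (R -> R) -> (R -> R) -> \bar R)
    (hd : d = @d_infty R \/ exists k : nat, (1 <= k)%N /\ d = @d_kuip R k)
    (s : nat -> R) (hs0 : forall n : nat, (1 <= n)%N -> 0 < s n)
    (hs : s =O_\oo (fun n : nat => Num.sqrt (ln (ln n%:R) / n%:R)))
    (h : nat -> {RV P >-> R})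
    (hh0 : forall (n : nat) (w : T), (1 <= n)%N -> 0 < h n w)
    (hh : {ae P, forall w, \forall n \near \oo,
       d (ecdf (fun i => X i w) n)
         (smoothed_ecdf K (fun i => X i w) n (h n w)) = (s n)%:E}) :
  {ae P, forall w,
    (fun n : nat => h n w : R) =O_\oo
    (fun n : nat => n%:R `^ (- (2 * l)%:R^-1) *
                    (ln (ln n%:R)) `^ ((2 * l)%:R^-1))}.
Proof.
have iK := kernel_L1 hK.
have [N hN] := bandwidth_bound hK.
have [M hits] := ae_eventually_few_hits N hX.
have {hN} [C [S0 [C0 S00 hC]]] := hN M.
have /eqO_exP [k k0 sk] := hs.
(* Below this threshold for (ln ln n)/n, the bound [k * v] on [s n] is smaller than [S0]. *)
have Sk0 : 0 < (S0 / k) ^+ 2 by rewrite exprn_gt0// divr_gt0.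
apply: filterS2 hh hits => w hd_w hits_w.
(* The comparison is made between [l]-th powers: a base of at least 1 gives
   [C * k <= (1 + C * k) ^+ l], with no root of [C * k] to extract. *)
apply/eqO_exP; exists (1 + C * k); first by rewrite addr_gt0// mulr_gt0.
near=> n.
have skn : `|s n| <= k * `|Num.sqrt (ln (ln n%:R) / n%:R)|.
  by near: n; exact: sk.
have n0 : (0 < n)%N by near: n; exists 1%N.
have nR0 : (0 : R) < n%:R by rewrite ltr0n.
have [L0 Lc] : 0 <= ln (ln n%:R : R) /\ ln (ln n%:R) / n%:R < (S0 / k) ^+ 2.
  by near: n; exact: ln_ln_div_small.
pose v : R := Num.sqrt (ln (ln n%:R) / n%:R).
pose r : R := n%:R `^ (- (2 * l)%:R^-1) * (ln (ln n%:R)) `^ ((2 * l)%:R^-1).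
have l1 : (1 <= l)%N by exact: ltnW.
have rv : r ^+ l = v by exact: powR_rate.
have r0 : 0 <= r by rewrite mulr_ge0// powR_ge0.
have v0 : 0 <= v by exact: sqrtr_ge0.
have sv : s n <= k * v.
  by move: skn; rewrite (ger0_norm v0); exact: le_trans (ler_norm _).
have vS : k * v < S0.
  rewrite mulrC -ltr_pdivlMr// -(@ltr_pXn2r _ 2)//
    ?nnegrE ?divr_ge0 ?(ltW S00) ?(ltW k0)//.
  by rewrite sqr_sqrtr// divr_ge0// ltW.
have dn : d (ecdf (fun i => X i w) n)
    (smoothed_ecdf K (fun i => X i w) n (h n w)) = (s n)%:E.
  by near: n; exact: hd_w.
have hn := hh0 n w n0.
have dev t : `|ecdf (fun i => X i w) n t -
    smoothed_ecdf K (fun i => X i w) n (h n w) t| <= s n.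
  case: hd dn => [->|[j [j1 ->]]] dn; first exact: d_infty_le.
  exact: d_kuip_sup_le dn.
have few : (N * #|[pred i : 'I_n | (M < `|X i w|)%R]| < n)%N.
  by near: n; exact: hits_w.
have hl_le := hC n (fun i => X i w) _ _ few hn dev (le_lt_trans sv vS).
rewrite -/r (ger0_norm r0) gtr0_norm//.
have c1 : 1 <= 1 + C * k by rewrite lerDl mulr_ge0// ltW.
have cr0 : 0 <= (1 + C * k) * r := mulr_ge0 (le_trans ler01 c1) r0.
rewrite -(@ler_pXn2r _ l)// ?nnegrE ?(ltW hn)//.
rewrite exprMn rv (le_trans hl_le)// (le_trans (ler_wpM2l (ltW C0) sv))//.
rewrite mulrA ler_wpM2r// (@le_trans _ _ (1 + C * k))//.
  by rewrite lerDr.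
by rewrite -[leLHS]expr1 ler_weXn2l.
Unshelve. all: by end_near. Qed.
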